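(* Let $E\subset\mathbb{R}$ be a measurable set of finite Lebesgue measure, let $f=\chi_E$, and let $g\in L^1(\mathbb{R})$ be a nonnegative function such that $N_g=N_f$ almost everywhere on $\mathbb{R}^2$. Then there exists a measurable set $F\subset\mathbb{R}$ of finite measure such that $g=\chi_F$ (almost everywhere).
   Context: $\chi_E$ denotes the characteristic function of $E$. For nonnegative $f\in L^1(\mathbb{R})$, $N_f$ is the $3$-deck of $f$, i.e. the function on $\mathbb{R}^2$ given by $N_f(x_1,x_2)=\int_{\mathbb{R}} f(t)f(t+x_1)f(t+x_2)\,dt$. *)

(* Defs.v *)
From HB Require Import structures.
From mathcomp Require Import all_boot all_order all_algebra.
From mathcomp Require Import all_classical all_reals all_analysis.

Set Implicit Arguments.
Unset Strict Implicit.
Unset Printing Implicit Defensive.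

Import Order.TTheory GRing.Theory Num.Theory.
Import numFieldNormedType.Exports.

Local Open Scope classical_set_scope.
Local Open Scope ring_scope.

(* The carrier of [lebesgueR R] is [R]; its measurable sets
   are the Lebesgue (not only the Borel) measurable sets: it is the domain of
   [completed_lebesgue_measure]. *)
Notation lebesgueR R := (caratheodory_type (wlength (@idfun R))^*%mu).

(* Extended-valued: for f nonnegative in L^1 the integral is finite for almost
   every x, but it can be +oo on a null set. *)
Definition deck3 (R : realType) (f : R -> R) (x : R * R) : \bar R :=
  (\int[completed_lebesgue_measure]_t
     (f t * f (t + x.1)%R * f (t + x.2)%R)%:E)%E.

(* Main.v *)
(* Write m = |E|. Integrating N_g = N_f against u(x1) v(x2) gives, by Tonelli,
   that the integral of g S_u S_v, with S_u(t) = \int u(x) g(t + x) dx, is the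
   same for g and f. With u = v = 1 this yields \int g = m. With
   u = v = (2r)^-1 \1_(-r, r) and r -> 0, Lebesgue differentiation and Fatou
   yield \int g^3 <= m. With u = (2r)^-1 \1_(-r, r) and v = 1, the left-hand
   side is at most m \int g^2 by AM-GM, while the limit inferior of the
   right-hand side is at least m^2 by Fatou, so m <= \int g^2. Hence
   \int g (1 - g)^2 = \int g - 2 \int g^2 + \int g^3 <= 0, and g is
   {0, 1}-valued almost everywhere. *)

Require Import Defs.
From HB Require Import structures.
From mathcomp Require Import all_boot all_order all_algebra.
From mathcomp Require Import all_classical all_reals all_analysis.
From mathcomp Require Import measurable_realfun ring.
Import Order.TTheory GRing.Theory Num.Theory.
Import numFieldNormedType.Exports.
Local Open Scope classical_set_scope.
Local Open Scope ring_scope.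

(** * Translation invariance of Lebesgue measure *)

Section translation.
Context {R : realType}.
Notation mu := (@lebesgue_measure R).
Local Open Scope ereal_scope.

Lemma measurable_addr (a : R) :
  measurable_fun [set: measurableTypeR R]
    (fun x : measurableTypeR R => (x + a)%R : measurableTypeR R).
Proof. by apply: measurable_funD. Qed.

(** Lebesgue measure is determined by its values on half-open intervals, and a shift sends such an
    interval to one of the same length. *)
Lemma lebesgue_measureD (a : R) (A : set (measurableTypeR R)) : measurable A ->
  pushforward mu (fun x : measurableTypeR R => (x + a)%R : measurableTypeR R) A
  = mu A.
Proof.
move=> mA; apply/esym.
pose phi : measurableTypeR R -> measurableTypeR R := fun x => (x + a)%R.
have mphi : measurable_fun setT phi by exact: measurable_addr.
apply: lebesgue_measure_unique => // _ [[b c]] _ <-.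
have phi_itv : phi @^-1` `]b, c]%classic =
    `](b - a)%R, (c - a)%R]%classic.
  by apply/seteqP; split => x /=; rewrite /phi !in_itv /= ltrBlDr lerBrDr.
rewrite -[RHS]/(mu (phi @^-1` _)) phi_itv !lebesgue_measure_itv/=.
rewrite !lte_fin ltrD2r.
by case: ifP => // _; rewrite -!EFinB; congr EFin; rewrite opprB addrA subrK.
Qed.

Lemma ge0_integral_shift (D : set R) (f : R -> \bar R) (a : R) :
  measurable (D : set (measurableTypeR R)) ->
  measurable_fun (D : set (measurableTypeR R)) f ->
  (forall x, D x -> 0 <= f x) ->
  \int[mu]_(x in D) f x = \int[mu]_(x in [set y | D (y + a)%R]) f (x + a)%R.
Proof.
move=> mD mf f0.
pose phi : measurableTypeR R -> measurableTypeR R := fun x => (x + a)%R.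
have mphi : measurable_fun setT phi by exact: measurable_addr.
rewrite -(ge0_integral_pushforward mphi mu mD mf); last first.
  by move=> y; rewrite inE; exact: f0.
by apply: eq_measure_integral => //= A mA AS; exact/esym/lebesgue_measureD.
Qed.

End translation.

(** * Tonelli for the Borel 3-deck, and the AM-GM bound *)

Section smear.
Context {R : realType}.
Notation mu := (@lebesgue_measure R).
Notation T := (measurableTypeR R).
Local Open Scope ereal_scope.
Implicit Types h u v : R -> R.

(* [deck3] integrates against the completed measure; on Borel functions the two
   agree, and Tonelli's theorem is available for [lebesgue_measure]. *)
Definition bdeck3 h (p : T * T) :=
  \int[mu]_t (h t * h (t + p.1) * h (t + p.2))%:E.
(** The function [S_u] built from [h]: the cross-correlation of [u] with [h]. *)
Definition smear h u (t : R) := \int[mu]_x (u x * h (t + x))%:E.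

Lemma smear_ge0 {h u} t : (forall x, 0 <= h x)%R -> (forall x, 0 <= u x)%R ->
  0 <= smear h u t.
Proof.
by move=> h0 u0; apply: integral_ge0 => x _; rewrite lee_fin mulr_ge0.
Qed.

Lemma measurable_fun_smear_integrand h u : measurable_fun (setT : set T) h ->
  measurable_fun (setT : set T) u ->
  measurable_fun (setT : set (T * T))
    (fun p : T * T => (u p.2 * h (p.1 + p.2))%:E).
Proof.
move=> mh mu_; apply/measurable_EFinP; apply: measurable_funM.
  exact: measurableT_comp.
by apply: (measurableT_comp mh); exact: measurable_funD.
Qed.

Lemma measurable_smear {h u} : measurable_fun (setT : set T) h ->
  measurable_fun (setT : set T) u ->
  (forall x, 0 <= h x)%R -> (forall x, 0 <= u x)%R ->
  measurable_fun (setT : set T) (smear h u).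
Proof.
move=> mh mu_ h0 u0.
apply: (measurable_fun_fubini_tonelli_F (m2 := mu)
  (fun p : T * T => (u p.2 * h (p.1 + p.2))%:E)).
  exact: measurable_fun_smear_integrand.
by move=> x; rewrite lee_fin mulr_ge0.
Qed.

(** Tonelli makes [t] the outermost variable; for fixed [t] the integrand is a product of a function
    of [x1] and a function of [x2], and each factor integrates to a [smear]. *)
Lemma integral_bdeck3 h u v : measurable_fun (setT : set T) h ->
  measurable_fun (setT : set T) u -> measurable_fun (setT : set T) v ->
  (forall x, 0 <= h x)%R -> (forall x, 0 <= u x)%R -> (forall x, 0 <= v x)%R ->
  \int[mu \x mu]_p ((u p.1 * v p.2)%:E * bdeck3 h p) =
  \int[mu]_t ((h t)%:E * (smear h u t * smear h v t)).
Proof.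
move=> mh mu_ mv h0 u0 v0.
pose k (q : (T * T) * T) :=
  ((u q.1.1 * v q.1.2) * (h q.2 * h (q.2 + q.1.1) * h (q.2 + q.1.2)))%:E.
have k0 q : 0 <= k q by rewrite lee_fin !mulr_ge0.
have mk : measurable_fun setT k.
  apply/measurable_EFinP.
  repeat apply: measurable_funM;
  [apply: (measurableT_comp mu_)|apply: (measurableT_comp mv)|
   apply: (measurableT_comp mh)|apply: (measurableT_comp mh)|
   apply: (measurableT_comp mh)] => //;
  try apply: measurable_funD => //; by apply: measurableT_comp.
transitivity (\int[mu \x mu]_p \int[mu]_t k (p, t)).
  apply: eq_integral => p _; rewrite -ge0_integralZl//.
  - apply/measurable_EFinP; repeat apply: measurable_funM => //;
    by apply: (measurableT_comp mh); exact: measurable_funD.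
  - by move=> t _; rewrite lee_fin !mulr_ge0.
  - by rewrite lee_fin mulr_ge0.
rewrite fubini_tonelli1; last 2 first.
- exact: (measurable_fun_fubini_tonelli_F (m2 := mu) k).
- by move=> p; exact: integral_ge0.
rewrite /fubini_F /=.
(* [l (x1, t)] is what remains of [k] once [x2] has been integrated out; a second exchange, of [x1]
   and [t], then finishes. *)
pose l (q : T * T) := (h q.2)%:E * (u q.1 * h (q.2 + q.1))%:E * smear h v q.2.
have l0 q : 0 <= l q.
  by rewrite !mule_ge0// ?lee_fin ?mulr_ge0//; exact: smear_ge0.
have ml : measurable_fun setT l.
  apply: emeasurable_funM; last first.
    exact: (measurableT_comp (measurable_smear mh mv h0 v0)).
  apply: emeasurable_funM; apply/measurable_EFinP.
    exact: measurableT_comp.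
  apply: measurable_funM; first exact: measurableT_comp.
  by apply: (measurableT_comp mh); exact: measurable_funD.
have mS (w : R -> R) (t : R) : measurable_fun (setT : set T) w ->
    measurable_fun (setT : set T) (fun x : T => (w x * h (t + x))%:E).
  move=> mw; apply/measurable_EFinP; apply: measurable_funM => //.
  by apply: (measurableT_comp mh); exact: measurable_funD.
transitivity (\int[mu]_x \int[mu]_t l (x, t)).
  apply: eq_integral => x _.
  rewrite (fubini_tonelli (fun q : T * T => k (x, q.1, q.2)))//=; last first.
    apply: (measurableT_comp mk); apply: measurable_fun_pair => //=.
    exact: measurable_fun_pair.
  apply: eq_integral => t _; rewrite /l /= -EFinM -ge0_integralZl//.
  - by apply: eq_integral => y _; rewrite /k /= -EFinM; congr EFin;
    rewrite !mulrA [LHS](ACl (3*1*4*2*5))/=.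
  - exact: mS.
  - by move=> y _; rewrite lee_fin !mulr_ge0.
  - by rewrite lee_fin !mulr_ge0.
rewrite (fubini_tonelli l)//; apply: eq_integral => t _; rewrite /l /=.
rewrite ge0_integralZr//; last 3 first.
- by apply: emeasurable_funM => //; exact: mS.
- by move=> x _; rewrite mule_ge0// lee_fin ?mulr_ge0.
- exact: smear_ge0.
rewrite ge0_integralZl ?muleA// ?lee_fin//; first exact: mS.
by move=> x _; rewrite lee_fin mulr_ge0.
Qed.

Lemma smear1 h t : measurable_fun (setT : set T) h -> (forall x, 0 <= h x)%R ->
  smear h (cst 1%R) t = \int[mu]_x (h x)%:E.
Proof.
move=> mh h0; rewrite (@ge0_integral_shift _ setT (EFin \o h) t)//=.
- by apply: eq_integral => x _; rewrite mul1r addrC.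
- exact/measurable_EFinP.
- by move=> x _; rewrite lee_fin.
Qed.

(** For each shift [x], AM-GM and translation invariance bound the autocorrelation of [h] at [x] by
    the integral of [h ^+ 2]; averaging over [x] with the weight [u] of mass 1 keeps the bound. The
    bound may be [+oo]. *)
Lemma integral_mul_smear_le h u : measurable_fun (setT : set T) h ->
  measurable_fun (setT : set T) u ->
  (forall x, 0 <= h x)%R -> (forall x, 0 <= u x)%R ->
  \int[mu]_x (u x)%:E = 1 ->
  \int[mu]_t ((h t)%:E * smear h u t) <= \int[mu]_t (h t ^+ 2)%:E.
Proof.
move=> mh mu_ h0 u0 u1.
have mh2 : measurable_fun (setT : set T) (fun t => (h t ^+ 2)%:E).
  by apply/measurable_EFinP; exact: measurable_funX.
pose k (q : T * T) := (u q.2 * (h q.1 * h (q.1 + q.2)))%:E.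
have k0 q : 0 <= k q by rewrite lee_fin !mulr_ge0.
have mk : measurable_fun setT k.
  apply/measurable_EFinP; repeat apply: measurable_funM;
  [apply: (measurableT_comp mu_)|apply: (measurableT_comp mh)|
   apply: (measurableT_comp mh)] => //.
  by apply: measurable_funD.
have -> : \int[mu]_t ((h t)%:E * smear h u t) = \int[mu]_t \int[mu]_x k (t, x).
  apply: eq_integral => t _; rewrite -ge0_integralZl//.
  - by apply: eq_integral => x _; rewrite /k -EFinM mulrCA.
  - apply/measurable_EFinP; apply: measurable_funM => //.
    by apply: (measurableT_comp mh); exact: measurable_funD.
  - by move=> x _; rewrite lee_fin mulr_ge0.
  - by rewrite lee_fin.
rewrite (fubini_tonelli k)//=.
set I := \int[mu]_t (h t ^+ 2)%:E.
have I0 : 0 <= I by apply: integral_ge0 => t _; rewrite lee_fin sqr_ge0.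
have mhh x : measurable_fun (setT : set T) (fun t : T => (h t * h (t + x))%:E).
  apply/measurable_EFinP; apply: measurable_funM => //.
  by apply: (measurableT_comp mh); exact: measurable_funD.
have hh x : \int[mu]_t (h t * h (t + x))%:E <= I.
  rewrite -(@lee_pmul2l _ 2%:E)// -ge0_integralZl//; last 1 first.
  - by move=> t _; rewrite lee_fin mulr_ge0.
  have -> : 2%:E * I = I + I.
    by rewrite mule_natl mule2n.
  (* Shifting one of the two copies of [I] by [x] reduces the claim to the pointwise inequality 2ab
     <= a^2 + b^2. *)
  rewrite {2}/I (@ge0_integral_shift _ setT (fun t => (h t ^+ 2)%:E) x)//=;
    last first.
    by move=> t _; rewrite lee_fin sqr_ge0.
  rewrite -ge0_integralD//=.
  - apply: ge0_le_integral => //=.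
    + by move=> t _; rewrite lee_fin !mulr_ge0.
    + exact: measurable_funeM.
    + apply: emeasurable_funD => //; apply/measurable_EFinP/measurable_funX.
      by apply: (measurableT_comp mh); exact: measurable_funD.
    + move=> t _; rewrite -EFinM -EFinD lee_fin -subr_ge0.
      by have := sqr_ge0 (h t - h (t + x))%R; rewrite sqrrB mulr_natl addrAC.
  - by move=> t _; rewrite lee_fin sqr_ge0.
  - by move=> t _; rewrite lee_fin sqr_ge0.
  - apply/measurable_EFinP/measurable_funX.
    by apply: (measurableT_comp mh); exact: measurable_funD.
apply: (@le_trans _ _ (\int[mu]_x ((u x)%:E * I))).
  apply: ge0_le_integral => //=.
  - by move=> x _; exact: integral_ge0.
  - exact: (measurable_fun_fubini_tonelli_G k).
  - by apply: emeasurable_funM => //; exact/measurable_EFinP.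
  - move=> x _; rewrite /k /=.
    under eq_integral do rewrite EFinM.
    rewrite ge0_integralZl//.
    + by apply: lee_wpmul2l; rewrite ?lee_fin.
    + by move=> t _; rewrite lee_fin mulr_ge0.
    + by rewrite lee_fin.
rewrite ge0_integralZr//.
- by rewrite u1 mul1e.
- exact/measurable_EFinP.
- by move=> x _; rewrite lee_fin.
Qed.

End smear.

(** Fatou's lemma on the complement of a null set outside which the sequence converges; a uniform
    bound on the integrals passes to the limit. *)
Lemma ae_fatou_le d (T : measurableType d) (R : realType)
    (mu : {measure set T -> \bar R}) (f_ : (T -> \bar R)^nat) (f : T -> \bar R)
    (M : \bar R) :
  (forall n, measurable_fun setT (f_ n)) -> (forall n x, 0 <= f_ n x)%E ->
  measurable_fun setT f -> (forall x, 0 <= f x)%E ->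
  {ae mu, forall x, f_ n x @[n --> \oo] --> f x} ->
  (forall n, \int[mu]_x f_ n x <= M)%E -> (\int[mu]_x f x <= M)%E.
Proof.
move=> mf_ f_0 mf f0 [N [mN N0 subN]] intM.
have mNC : measurable (setT `\` N) by exact: measurableD.
rewrite (ge0_negligible_integral mN)//.
apply: (@le_trans _ _ (\int[mu]_(x in setT `\` N) limn_einf (f_ ^~ x))%E).
  rewrite le_eqVlt; apply/orP; left; apply/eqP; apply: eq_integral => x.
  rewrite inE => -[_ Nx]; apply/esym.
  have fx : f_ n x @[n --> \oo] --> f x by apply: contrapT => /subN.
  rewrite (is_cvg_limn_einfE (cvgP _ fx)); exact/cvg_lim.
apply: le_trans.
  apply: fatou => // n; exact: measurable_funS (mf_ n).
rewrite limn_einf_lim; apply: lime_le; first exact: is_cvg_einfs.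
near=> n; apply: (@le_trans _ _ (\int[mu]_(x in setT `\` N) f_ n x)%E).
  by apply: ereal_inf_lbound; exists n => //=.
by apply: le_trans (intM n); apply: ge0_subset_integral.
Unshelve. all: by end_near. Qed.

(** * Averages over shrinking balls and Lebesgue differentiation *)

Section avg_kernel.
Context {R : realType}.
Notation mu := (@lebesgue_measure R).
Notation T := (measurableTypeR R).
Local Open Scope ereal_scope.

(** The kernel (2r)^-1 \1_(-r, r) with r = 1/(n+1), a radius that is positive for every [n]. *)
Definition avg_kernel (n : nat) (x : R) : R :=
  ((n.+1%:R^-1 *+ 2)^-1 * \1_(ball (0%R : R) n.+1%:R^-1) x)%R.

Lemma avg_kernel_ge0 n x : (0 <= avg_kernel n x)%R.
Proof. by rewrite mulr_ge0// invr_ge0 mulrn_wge0// invr_ge0. Qed.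

Lemma measurable_avg_kernel n : measurable_fun (setT : set T) (avg_kernel n).
Proof.
apply: measurable_funM => //.
by apply: measurable_indic; exact: measurable_ball.
Qed.

Lemma integral_avg_kernel n : \int[mu]_x (avg_kernel n x)%:E = 1.
Proof.
under eq_integral do rewrite EFinM.
rewrite ge0_integralZl//=; last first.
  by apply/measurable_EFinP/measurable_indic; exact: measurable_ball.
rewrite integral_indic//; last exact: measurable_ball.
rewrite setIT.
rewrite [X in _ * X](_ : _ = (n.+1%:R^-1 *+ 2)%R%:E);
  last exact: lebesgue_measure_ball.
by rewrite -EFinM mulVf// mulrn_eq0.
Qed.

(** Shifting by [t] recentres the kernel's ball; this is the form of the average to which Lebesgue
    differentiation applies. *)
Lemma smear_avg_kernel (h : R -> R) n t : measurable_fun (setT : set T) h ->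
  (forall x, 0 <= h x)%R ->
  smear h (avg_kernel n) t = (mu (ball t n.+1%:R^-1))^-1 *
                       \int[mu]_(y in ball t n.+1%:R^-1) (h y)%:E.
Proof.
move=> mh h0.
have mb x r : measurable (ball x r : set T) by exact: measurable_ball.
rewrite (@ge0_integral_shift _ (ball t n.+1%:R^-1) (EFin \o h) t)//=;
  last 2 first.
- by apply/measurable_EFinP; exact: measurable_funS mh.
- by move=> x _; rewrite lee_fin.
rewrite lebesgue_measure_ball// inver mulrn_eq0/= gt_eqF//.
have -> : [set y | ball t n.+1%:R^-1 (y + t)%R] = ball (0%R : R) n.+1%:R^-1.
  apply/seteqP; split => y /=; rewrite /ball/= sub0r opprD addrCA subrr addr0//.
rewrite integral_mkcond epatch_indic -ge0_integralZl//; last 2 first.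
- apply: emeasurable_funM; apply/measurable_EFinP.
    by apply: (measurableT_comp mh); exact: measurable_addr.
  by apply: measurable_indic; exact: mb.
- by move=> x _; rewrite mule_ge0// lee_fin.
apply: eq_integral => x _.
by rewrite /avg_kernel -!EFinM (addrC t) mulrA mulrAC.
Qed.

Lemma smear_avg_kernel_cvg (h : R -> R) :
  mu.-integrable (setT : set T) (EFin \o h) -> (forall x, 0 <= h x)%R ->
  {ae mu, forall t : T, smear h (avg_kernel n) t @[n --> \oo] --> (h t)%:E}.
Proof.
move=> ih h0.
have mh : measurable_fun (setT : set T) h.
  by apply/measurable_EFinP; exact: measurable_int ih.
have lh : locally_integrable setT h.
  by apply: open_integrable_locally => //; exact: openT.
have hE (x : R) : nicely_shrinking x (fun n => ball x n.+1%:R^-1).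
  split; first by move=> n; exact: measurable_ball.
  (* The sets are balls already, so each serves as its own enclosing ball, with constant 1. *)
  exists (1%R, fun n => PosNum (ltac:(by []) : 0 < n.+1%:R^-1 :> R)%R).
  split => //=.
  - exact: cvg_harmonic.
  - by move=> n; exact: subset_refl.
  - by move=> n; rewrite mul1e.
apply: (@filterS _ _ (ae_filter_ringOfSetsType mu))
  (lebesgue_differentiation lh) => t ht.
under eq_fun do rewrite smear_avg_kernel//.
exact: (nice_lebesgue_differentiation hE).
Qed.

End avg_kernel.

(** * The inequalities between moments, for Borel functions *)

Section borel_deck.
Context {R : realType}.
Notation mu := (@lebesgue_measure R).
Notation T := (measurableTypeR R).
Local Open Scope ereal_scope.
Implicit Types f g h u v : R -> R.

Lemma measurable_bdeck3 h : measurable_fun (setT : set T) h ->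
  (forall x, 0 <= h x)%R -> measurable_fun (setT : set (T * T)) (bdeck3 h).
Proof.
move=> mh h0.
pose k (q : (T * T) * T) := (h q.2 * h (q.2 + q.1.1) * h (q.2 + q.1.2))%:E.
apply: (measurable_fun_fubini_tonelli_F (m2 := mu) k).
  apply/measurable_EFinP; repeat apply: measurable_funM;
  apply: (measurableT_comp mh) => //; apply: measurable_funD => //;
  by apply: measurableT_comp.
by move=> q; rewrite lee_fin !mulr_ge0.
Qed.

(** Each side is the integral of a 3-deck against [u(x1) v(x2)], which does not see the null set
    where the decks differ. *)
Lemma deck3_eq_smear h f u v :
  measurable_fun (setT : set T) h -> measurable_fun (setT : set T) f ->
  measurable_fun (setT : set T) u -> measurable_fun (setT : set T) v ->
  (forall x, 0 <= h x)%R -> (forall x, 0 <= f x)%R ->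
  (forall x, 0 <= u x)%R -> (forall x, 0 <= v x)%R ->
  {ae (mu \x mu), forall p : T * T, bdeck3 h p = bdeck3 f p} ->
  \int[mu]_t ((h t)%:E * (smear h u t * smear h v t)) =
  \int[mu]_t ((f t)%:E * (smear f u t * smear f v t)).
Proof.
move=> mh mf mu_ mv h0 f0 u0 v0 hf.
rewrite -(integral_bdeck3 h u v mh mu_ mv h0 u0 v0)
  -(integral_bdeck3 f u v mf mu_ mv f0 u0 v0).
have muv : measurable_fun (setT : set (T * T))
    (fun p : T * T => (u p.1 * v p.2)%:E).
  by apply/measurable_EFinP; apply: measurable_funM; exact: measurableT_comp.
have b0 (g : R -> R) p : (forall x, 0 <= g x)%R ->
    0 <= (u p.1 * v p.2)%:E * bdeck3 g p.
  move=> g0; rewrite mule_ge0// ?lee_fin ?mulr_ge0//.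
  by apply: integral_ge0 => t _; rewrite lee_fin !mulr_ge0.
apply: ge0_ae_eq_integral => //.
- by apply: emeasurable_funM => //; exact: measurable_bdeck3.
- by apply: emeasurable_funM => //; exact: measurable_bdeck3.
- by move=> p _; exact: b0.
- by move=> p _; exact: b0.
- by apply: (@filterS _ _ (ae_filter_ringOfSetsType (mu \x mu))) hf => p -> _.
Qed.

Lemma indic_deck3_ae01 (E : set T) h : measurable E -> mu E < +oo ->
  measurable_fun (setT : set T) h -> (forall x, 0 <= h x)%R ->
  \int[mu]_x (h x)%:E < +oo ->
  {ae (mu \x mu), forall p : T * T, bdeck3 h p = bdeck3 (\1_E : R -> R) p} ->
  {ae mu, forall t : T, h t = 0%R \/ h t = 1%R}.
Proof.
move=> mE finE mh h0 finh deckhE.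
pose f : R -> R := \1_E.
have mf : measurable_fun (setT : set T) f by exact: measurable_indic.
have f0 x : (0 <= f x)%R by rewrite /f indicE.
have f1 x : (f x <= 1)%R by rewrite /f indicE lern1 leq_b1.
have fE : \int[mu]_x (f x)%:E = mu E by rewrite integral_indic// setIT.
have int_h : mu.-integrable (setT : set T) (EFin \o h).
  apply/integrableP; split; first exact/measurable_EFinP.
  by under eq_integral => x _ do rewrite /= ger0_norm//.
have int_f : mu.-integrable (setT : set T) (EFin \o f).
  apply/integrableP; split; first exact/measurable_EFinP.
  by under eq_integral => x _ do rewrite /= ger0_norm//; rewrite fE.
have key := @deck3_eq_smear h f _ _ mh mf _ _ h0 f0 _ _ deckhE.
have c0 (x : R) : (0 <= cst (1%R : R) x)%R by [].
have b0 := @avg_kernel_ge0 R.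
have mb n := @measurable_avg_kernel R n.
have mc : measurable_fun (setT : set T) (cst (1%R : R)) by [].
have mS g n : measurable_fun (setT : set T) g -> (forall x, 0 <= g x)%R ->
  measurable_fun (setT : set T) (smear g (avg_kernel n)).
  by move=> mg g0; exact: measurable_smear.
have S0 g n t : (forall x, 0 <= g x)%R -> 0 <= smear g (avg_kernel n) t.
  by move=> g0; exact: smear_ge0.
have mEFin g : measurable_fun (setT : set T) g ->
  measurable_fun (setT : set T) (fun t => (g t)%:E).
  by move=> ?; exact/measurable_EFinP.
set m := mu E in fE finE.
set I := \int[mu]_x (h x)%:E in finh.
have I0 : 0 <= I by apply: integral_ge0 => x _; rewrite lee_fin.
have m0 : 0 <= m by exact: measure_ge0.
(* With [u = v = 1] the identity [key] reads [I * (I * I) = m * (m * m)]; both numbers are finite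
   and nonnegative, and cubing is injective there. *)
have Im : I = m.
  have := key _ _ mc mc c0 c0.
  under eq_integral do rewrite !smear1//.
  under [in RHS]eq_integral do rewrite !smear1//.
  rewrite fE -/I (ge0_integralZr _ _ (mEFin _ mh))// ?mule_ge0//; last first.
    by move=> x _; rewrite lee_fin.
  rewrite (ge0_integralZr _ _ (mEFin _ mf))// ?mule_ge0//; last first.
    by move=> x _; rewrite lee_fin.
  rewrite fE -/I.
  have := ge0_fin_numE I0; rewrite finh => /fineK <-.
  have := ge0_fin_numE m0; rewrite finE => /fineK <-.
  have := fine_ge0 I0; have := fine_ge0 m0.
  move: (fine I) (fine m) => i j j0 i0 [] /eqP.
  rewrite -!expr2 -!exprS eqrXn2// => /eqP ->//.
pose J2 := \int[mu]_t (h t ^+ 2)%:E.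
pose J3 := \int[mu]_t (h t ^+ 3)%:E.
have J3m : J3 <= m.
  apply: (ae_fatou_le _ _ _ mu
    (fun n t =>
      (h t)%:E * (smear h (avg_kernel n) t * smear h (avg_kernel n) t))).
  - move=> n; apply: emeasurable_funM; first exact: mEFin.
    by apply: emeasurable_funM; exact: mS.
  - by move=> n x; rewrite !mule_ge0// ?lee_fin//; exact: S0.
  - by apply: mEFin; exact: measurable_funX.
  - by move=> x; rewrite lee_fin exprn_ge0.
  - apply: (@filterS _ _ (ae_filter_ringOfSetsType mu))
      (smear_avg_kernel_cvg _ int_h h0) => t ht.
    rewrite exprS expr2 !EFinM; apply: cvgeM => //; first exact: cvg_cst.
    exact: cvgeM.
  (* [key] moves the integral to [f], whose averages are at most 1 because [f <= 1] and the kernel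
     has mass 1. *)
  - move=> n; rewrite (key _ _ (mb n) (mb n) (b0 n) (b0 n)) -fE.
    apply: ge0_le_integral => //.
    + by move=> t _; rewrite !mule_ge0// ?lee_fin//; exact: S0.
    + apply: emeasurable_funM; first exact: mEFin.
      by apply: emeasurable_funM; exact: mS.
    + exact: mEFin.
    move=> t _.
    have S1 : smear f (avg_kernel n) t <= 1.
      rewrite -(integral_avg_kernel n); apply: ge0_le_integral => //.
      * by move=> x _; rewrite lee_fin mulr_ge0.
      * apply: mEFin; apply: measurable_funM => //.
        by apply: (measurableT_comp mf); exact: measurable_funD.
      * exact: mEFin.
      * by move=> x _; rewrite lee_fin ler_piMr.
    rewrite -[leRHS]mule1 lee_wpmul2l ?lee_fin// -[leRHS]mule1.
    by apply: lee_pmul => //; exact: S0.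
have mJ2 : m <= J2.
  (* The case [m = 0] is set apart because a factor [m] is cancelled below. *)
  have [m_eq0|m_neq0] := eqVneq m 0.
    by rewrite m_eq0; apply: integral_ge0 => t _; rewrite lee_fin sqr_ge0.
  have sqf t : (f t)%:E = (f t)%:E * (f t)%:E.
    by rewrite -EFinM /f indicE; case: (_ \in _); rewrite ?mulr1 ?mulr0.
  (* An indicator is its own square, so [m] is the integral of the almost everywhere limit of
     [f * smear f (avg_kernel n)]. *)
  rewrite -fE; under eq_integral do rewrite sqf.
  apply: (ae_fatou_le _ _ _ mu
    (fun n t => (f t)%:E * smear f (avg_kernel n) t)).
  - by move=> n; apply: emeasurable_funM; [exact: mEFin|exact: mS].
  - by move=> n x; rewrite mule_ge0// ?lee_fin//; exact: S0.
  - by apply: emeasurable_funM; exact: mEFin.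
  - by move=> x; rewrite mule_ge0// lee_fin.
  - apply: (@filterS _ _ (ae_filter_ringOfSetsType mu))
      (smear_avg_kernel_cvg _ int_f f0) => t ft.
    by apply: cvgeM => //; exact: cvg_cst.
  - move=> n.
    have := key _ _ (mb n) mc (b0 n) c0.
    have split1 g : measurable_fun (setT : set T) g -> (forall x, 0 <= g x)%R ->
        \int[mu]_t
          ((g t)%:E * (smear g (avg_kernel n) t * smear g (cst 1%R) t)) =
        \int[mu]_t ((g t)%:E * smear g (avg_kernel n) t) * \int[mu]_x (g x)%:E.
      move=> mg g0; rewrite -ge0_integralZr//.
      - by apply: eq_integral => t _; rewrite smear1// muleA.
      - by apply: emeasurable_funM; [exact: mEFin|exact: mS].
      - by move=> t _; rewrite mule_ge0// ?lee_fin//; exact: S0.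
      - by apply: integral_ge0 => t _; rewrite lee_fin.
    (* Taking [v = 1] contributes a factor [I] on one side and [m] on the other; as [I = m], it
       cancels, which leaves the [h]-side to be bounded by AM-GM. *)
    rewrite (split1 _ mh h0) (split1 _ mf f0) fE -/I Im.
    have cancel_m (x y : \bar R) : x * m = y * m -> x = y.
      have mfin : m \is a fin_num by rewrite ge0_fin_numE.
      by move=> /(congr1 (fun z => z * m^-1)); rewrite -!muleA divee// !mule1.
    move=> /cancel_m <-.
    apply: integral_mul_smear_le => //; exact: integral_avg_kernel.
pose K := \int[mu]_t (h t * (1 - h t) ^+ 2)%:E.
have k0 t : (0 <= h t * (1 - h t) ^+ 2)%R by rewrite mulr_ge0// sqr_ge0.
have mk : measurable_fun (setT : set T) (fun t => h t * (1 - h t) ^+ 2)%R.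
  apply: measurable_funM => //; apply: measurable_funX.
  exact: measurable_funB.
have mp n : measurable_fun (setT : set T) (fun t => (h t ^+ n)%:E).
  by apply: mEFin; exact: measurable_funX.
(* The expansion of [h (1 - h)^2] is written without subtraction, since the integrals are extended
   reals. *)
have sum : K + (J2 + J2) = I + J3.
  have J20 x : 0 <= (h x ^+ 2)%:E by rewrite lee_fin sqr_ge0.
  rewrite /K /J2 /I /J3 -(ge0_integralD _ _ _ (mp 2%N) _ (mp 2%N))//.
  rewrite -(ge0_integralD _ _ _ (mEFin _ mk))//; last 3 first.
  - by move=> x _; rewrite lee_fin.
  - by move=> x _; rewrite adde_ge0.
  - by apply: emeasurable_funD; exact: mp.
  rewrite -(ge0_integralD _ _ _ (mEFin _ mh) _ (mp 3%N))//; last 2 first.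
  - by move=> x _; rewrite lee_fin.
  - by move=> x _; rewrite lee_fin exprn_ge0.
  apply: eq_integral => x _; rewrite -!EFinD; congr EFin; ring.
have K0 : K = 0.
  have K_ge0 : 0 <= K by apply: integral_ge0 => x _; rewrite lee_fin.
  have J2_ge0 : 0 <= J2 by apply: integral_ge0 => x _; rewrite lee_fin sqr_ge0.
  have mfin : m \is a fin_num by rewrite ge0_fin_numE.
  have le2m : K + (J2 + J2) <= m + m by rewrite sum Im leeD2l.
  (* Finiteness of [J2] allows it to be cancelled in [K + (J2 + J2) <= m + m <= J2 + J2]. *)
  have J2fin : J2 \is a fin_num.
    rewrite ge0_fin_numE//; apply: (@le_lt_trans _ _ (m + m)).
      by apply: le_trans le2m; rewrite addeA leeDr// adde_ge0.
    by rewrite -ge0_fin_numE ?adde_ge0// fin_numD mfin.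
  apply/eqP; rewrite eq_le K_ge0 andbT.
  have : K + (J2 + J2) <= 0 + (J2 + J2).
    by rewrite add0e; apply: le_trans le2m _; exact: leeD.
  by rewrite leeD2rE// fin_numD J2fin.
have /ae_eq_integral_abs : \int[mu]_t `|(h t * (1 - h t) ^+ 2)%:E| = 0.
  by under eq_integral => t _ do rewrite /= ger0_norm//.
move=> /(_ measurableT (mEFin _ mk)).
apply: (@filterS _ _ (ae_filter_ringOfSetsType mu)) => t /= /(_ Logic.I) [].
move=> /eqP; rewrite mulf_eq0 expf_eq0/= subr_eq0 => /orP[] /eqP.
  by left.
by right.
Qed.

End borel_deck.

(** * From Lebesgue measurable to Borel sets and functions *)

Section completion.
Context {R : realType}.
Notation mu := (@lebesgue_measure R).
Notation cmu := (@completed_lebesgue_measure R).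
Notation T := (measurableTypeR R).
Notation cT := (lebesgueR R).

Lemma measurable_caratheodory (A : set T) :
  measurable A -> measurable (A : set cT).
Proof. exact: sub_caratheodory. Qed.

(** The Carathéodory sigma-algebra is the completion of the Borel one: its members are Borel sets
    enlarged by subsets of Borel null sets. *)
Lemma caratheodory_measurableP (A : set cT) : measurable A ->
  exists B : set T, exists N : set T,
    [/\ measurable B, B `<=` A, measurable N, mu N = 0%E & A `\` B `<=` N].
Proof.
have -> : measurable A = (completed_algebra_gen mu).-sigma.-measurable A.
  by rewrite completed_caratheodory_measurable.
rewrite g_sigma_completed_algebra_genE => -[B mB [M [N [mN N0 MN]] <-]].
exists B, N; split; [exact: mB|by move=> x Bx; left|exact: mN|exact: N0|].
by move=> x [[//|Mx] _]; exact: MN.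
Qed.

(** A measurable null cover consists of a Borel part, null by monotonicity, and a remainder inside a
    Borel null set. *)
Lemma negligible_completed (A : set R) :
  cmu.-negligible A -> mu.-negligible A.
Proof.
move=> [C [mC C0 AC]].
have [B [N [mB BC mN N0 CBN]]] := caratheodory_measurableP C mC.
exists (B `|` N); split; first exact: measurableU.
- apply/eqP; rewrite -measure_le0.
  apply: le_trans (measureU2 mu mB mN) _.
  rewrite [X in (_ + X)%E](N0 : _ = 0%E) adde0 -C0.
  apply: (@le_measure _ _ _ cmu) => //; rewrite inE//.
  exact: measurable_caratheodory.
- move=> x /AC Cx; have [Bx|Bx] := pselect (B x); [by left|right].
  exact: CBN.
Qed.

Lemma negligible_lebesgue (A : set R) :
  mu.-negligible A -> cmu.-negligible A.
Proof.
by move=> [C [mC C0 AC]]; exists C; split => //; exact: measurable_caratheodory.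
Qed.

Lemma ae_completed (P : R -> Prop) :
  {ae cmu, forall x : cT, P x} <-> {ae mu, forall x : T, P x}.
Proof. by split; [exact: negligible_completed|exact: negligible_lebesgue]. Qed.

Lemma ae_shift (P : R -> Prop) (a : R) :
  {ae mu, forall x : T, P x} -> {ae mu, forall x : T, P (x + a)}.
Proof.
move=> [N [mN N0 PN]].
pose phi : T -> T := fun x => x + a.
exists (phi @^-1` N); split.
- by rewrite -[X in measurable X]setTI; exact: (measurable_addr a measurableT).
- exact: etrans (lebesgue_measureD a N mN) N0.
- by move=> x Px; exact: PN.
Qed.

Lemma measurable_fun_completed d (U : measurableType d) (f : R -> U) :
  measurable_fun (setT : set T) f -> measurable_fun (setT : set cT) f.
Proof. by move=> mf _ Y mY; apply: measurable_caratheodory; exact: mf. Qed.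

(** The identity from the completed to the Borel structure is measurable and pushes the completed
    measure forward to [mu]. *)
Lemma ge0_integral_completed (f : R -> \bar R) :
  measurable_fun (setT : set T) f -> (forall x, 0 <= f x)%E ->
  (\int[cmu]_x f x = \int[mu]_x f x)%E.
Proof.
move=> mf f0.
pose phi : cT -> T := id.
have mphi : measurable_fun setT phi.
  by apply: measurable_fun_completed; exact: measurable_id.
by rewrite -[LHS](ge0_integral_pushforward mphi cmu measurableT mf).
Qed.

Lemma negligible_bigcup_countable (I : countType) (F : I -> set T) :
  (forall i, mu.-negligible (F i)) -> mu.-negligible (\bigcup_i F i).
Proof.
move=> F0; pose G n : set T := if unpickle n is Some i then F i else set0.
apply: (@negligibleS _ _ _ mu (\bigcup_n G n)).
  by move=> x [i _ Fx]; exists (pickle i) => //; rewrite /G pickleK.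
apply: negligible_bigcup => n; rewrite /G; case: unpickle => //.
exact: negligible_set0.
Qed.

(** Each superlevel set of [g] at a rational has a Borel subset exhausting it up to a Borel null
    set; [h] is [g] set to 0 on the union [N] of these countably many null sets. The last clause
    gives pointwise control of [h] by [g]. *)
Lemma completed_measurable_borel (g : R -> R) :
  measurable_fun (setT : set cT) g ->
  exists h : R -> R, [/\ measurable_fun (setT : set T) h,
    {ae mu, forall x : T, h x = g x} & forall x, h x = g x \/ h x = 0].
Proof.
move=> mg.
have mgq (q : rat) : measurable (g @^-1` `]ratr q, +oo[%classic : set cT).
  by rewrite -[X in measurable X]setTI; exact: mg.
have /choice[BN BNP] : forall q : rat, exists BN : set T * set T,
    [/\ measurable BN.1, BN.1 `<=` g @^-1` `]ratr q, +oo[%classic,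
     measurable BN.2, mu BN.2 = 0%E &
     (g @^-1` `]ratr q, +oo[%classic) `\` BN.1 `<=` BN.2].
  move=> q; have [B [N ?]] := caratheodory_measurableP _ (mgq q).
  by exists (B, N).
pose N := \bigcup_q (BN q).2.
have mN : measurable N.
  by apply: bigcupT_measurable_rat => q; have [] := BNP q.
have N0 : mu N = 0%E.
  apply: measure_negligible => //; apply: negligible_bigcup_countable => q.
  by have [_ _ mq q0 _] := BNP q; exists (BN q).2; split.
pose h x := g x * \1_(~` N) x.
have hN x : N x -> h x = 0.
  by move=> Nx; rewrite /h indicE memNset ?mulr0//=; apply.
have hNC x : ~ N x -> h x = g x by move=> Nx; rewrite /h indicE mem_set ?mulr1.
exists h; split.
- apply: (measurability _ (RGenOInfty.measurableE R)) => // _ [_ [a ->] <-].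
  rewrite setTI.
  (* Off [N], a rational strictly between [a] and [g x] places [x] in one of the Borel subsets. On
     [N], where [h] is 0, all points belong when [a < 0] and none otherwise. *)
  have -> : h @^-1` `]a, +oo[%classic =
      ((\bigcup_(q in [set q : rat | a < ratr q]) (BN q).1) `\` N) `|`
      (if 0 > a then N else set0).
    apply/seteqP; split => x /=; rewrite ?in_itv/= ?andbT.
    + have [Nx|Nx] := pselect (N x).
        by rewrite hN// => ->; right.
      rewrite hNC// => /rat_in_itvoo[q]; rewrite inE => /itvP qi.
      left; split => //; exists q => /=; [by rewrite qi|apply: contrapT => Bx].
      apply: Nx; exists q => //; have [_ _ _ _] := BNP q; apply; split => //=.
      by rewrite in_itv/= qi.
    + move=> [[[q /= aq Bx] Nx]|].
        rewrite hNC//; have [_ /(_ _ Bx) /=] := BNP q.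
        by rewrite in_itv/= andbT => + _ _ _; exact: lt_trans.
      by case: ifPn => // a0 Nx; rewrite hN.
  apply: measurableU; last by case: ifP.
  apply: measurableD => //; rewrite bigcup_mkcond.
  apply: bigcupT_measurable_rat => q.
  by case: ifP => // _; have [] := BNP q.
- exists N; split => // x /= hx; apply: contrapT => Nx; exact/hx/hNC.
- by move=> x; have [/hN|/hNC] := pselect (N x); [right|left].
Qed.

(** Shifts preserve null sets, so for every [x], not just almost every one, the two integrands agree
    for almost all [t]. *)
Lemma deck3_borel (g h : R -> R) (x : R * R) :
  measurable_fun (setT : set T) h -> (forall x, 0 <= h x) ->
  {ae mu, forall t : T, h t = g t} -> deck3 g x = bdeck3 h x.
Proof.
move=> mh h0 hg.
pose k t := (h t * h (t + x.1) * h (t + x.2))%:E.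
have mk : measurable_fun (setT : set T) k.
  apply/measurable_EFinP; repeat apply: measurable_funM => //;
  by apply: (measurableT_comp mh); exact: measurable_addr.
have k0 t : (0 <= k t)%E by rewrite lee_fin !mulr_ge0.
rewrite /bdeck3 -(ge0_integral_completed _ mk k0).
have kg : ae_eq cmu setT k (fun t => (g t * g (t + x.1)%R * g (t + x.2)%R)%:E).
  apply/(ae_completed (fun t => setT t ->
    k t = (g t * g (t + x.1)%R * g (t + x.2)%R)%:E)).
  apply: (@filterS3 _ _ (ae_filter_ringOfSetsType mu))
    hg (ae_shift _ x.1 hg) (ae_shift _ x.2 hg).
  by move=> t /= h1 h2 h3 _; rewrite /k h1 h2 h3.
have mk' : measurable_fun (setT : set cT) k by exact: measurable_fun_completed.
(* Completeness makes the integrand of [g] measurable, as it agrees almost everywhere with [k]. *)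
have mg' := ae_measurable_fun completed_lebesgue_measure_is_complete kg mk'.
exact/esym/(ae_eq_integral _ _ measurableT mk' mg' kg).
Qed.

End completion.

(* The null sets of R^2 are those of [lebesgue_measure \x lebesgue_measure]:
   [{ae _, _}] only asks the exceptional set to be included in a measurable set
   of measure zero, so the product need not be completed. *)
Theorem proposition2p7 (R : realType) (E : set (lebesgueR R)) (g : R -> R)
    (mE : measurable E)
    (finE : (completed_lebesgue_measure E < +oo)%E)
    (intg : completed_lebesgue_measure.-integrable [set: lebesgueR R]
              (fun t => (g t)%:E))
    (g_ge0 : {ae completed_lebesgue_measure, forall t : lebesgueR R, 0 <= g t})
    (deck_eq : {ae (lebesgue_measure \x lebesgue_measure)%E,
                  forall x : R * R, deck3 g x = deck3 (\1_E : R -> R) x}) :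
  exists F : set (lebesgueR R),
    [/\ measurable F,
        (completed_lebesgue_measure F < +oo)%E
      & {ae completed_lebesgue_measure,
          forall t : lebesgueR R, g t = (\1_F : R -> R) t}].
Proof.
pose mu := @lebesgue_measure R; pose cmu := @completed_lebesgue_measure R.
have mg : measurable_fun (setT : set (lebesgueR R)) g.
  by apply/measurable_EFinP; exact: measurable_int intg.
have [h [mh hg hg0]] := completed_measurable_borel g mg.
(* [g] is nonnegative only almost everywhere; the truncation makes its Borel version nonnegative at
   every point. *)
pose h' (x : measurableTypeR R) : R := Num.max (h x) 0.
have mh' : measurable_fun setT h' by exact: measurable_maxr.
have h'0 x : 0 <= h' x by rewrite le_max lexx orbT.
have h'g : {ae mu, forall x : measurableTypeR R, h' x = g x}.
  apply: (@filterS2 _ _ (ae_filter_ringOfSetsType mu))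
    hg ((ae_completed _).1 g_ge0) => x /= hx g0.
  by rewrite /h' hx; exact/max_idPl.
have [B [N [mB BE mN N0 EBN]]] := caratheodory_measurableP E mE.
have BE_ae : {ae mu, forall x : measurableTypeR R,
    (\1_B : R -> R) x = (\1_E : R -> R) x}.
  exists N; split => // x /= xBE; apply: EBN; rewrite /setD/=.
  apply: contrapT => xEB; apply: xBE; rewrite !indicE.
  congr (_%:R); congr nat_of_bool.
  have [Bx|Bx] := pselect (B x); first by rewrite !mem_set//; exact: BE.
  by rewrite !memNset// => Ex; apply: xEB.
have finB : (mu B < +oo)%E.
  apply: le_lt_trans finE; apply: (@le_measure _ _ _ cmu) => //; rewrite inE//.
  exact: measurable_caratheodory.
have mh'E : measurable_fun (setT : set (measurableTypeR R)) (EFin \o h').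
  exact/measurable_EFinP.
have /integrableP[mgE fing] := intg.
have fin_h' : (\int[mu]_x (h' x)%:E < +oo)%E.
  rewrite -(ge0_integral_completed (EFin \o h') mh'E); last first.
    by move=> x; rewrite lee_fin.
  apply: le_lt_trans fing.
  apply: ge0_le_integral.
  - exact: measurableT.
  - by move=> x _; rewrite lee_fin.
  - exact: measurable_fun_completed.
  - exact: measurableT_comp.
  (* Since [h x] is [g x] or 0 at every [x], [h'] is dominated by the absolute value of [g]
     everywhere. *)
  - move=> x _; rewrite /= lee_fin /h' ge_max normr_ge0 andbT.
    by have [->|->] := hg0 x; rewrite ?ler_norm ?normr_ge0.
have h'01 : {ae mu, forall t : measurableTypeR R, h' t = 0 \/ h' t = 1}.
  apply: (indic_deck3_ae01 B h') => //.
  apply: (@filterS _ _ (ae_filter_ringOfSetsType (mu \x mu)%E)) deck_eq => p.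
  rewrite (deck3_borel g h' p mh' h'0 h'g) (deck3_borel \1_E \1_B)//.
exists (g @^-1` [set 1]).
have mF : measurable (g @^-1` [set 1] : set (lebesgueR R)).
  by rewrite -[X in measurable X]setTI; exact: mg.
split => //.
(* The indicator of the set where [g = 1] is at most the absolute value of [g], so integrability
   bounds its measure. *)
- apply: le_lt_trans fing; rewrite -(setIT (g @^-1` _)) -integral_indic//.
  apply: ge0_le_integral.
  - exact: measurableT.
  - by [].
  - exact/measurable_EFinP/measurable_indic.
  - exact: measurableT_comp.
  - move=> x _; rewrite /= lee_fin indicE.
    by have [/[!inE] /= ->|_] := boolP (x \in _); rewrite ?normr1 ?normr_ge0.
- apply/ae_completed.
  apply: (@filterS2 _ _ (ae_filter_ringOfSetsType mu)) h'01 h'g => t /= + h'gt.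
  rewrite h'gt indicE => -[gt|gt].
  + by rewrite memNset//= gt => /eqP; rewrite eq_sym oner_eq0.
  + by rewrite mem_set.
Qed.
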